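(* Let $K$ be a group, let $(PQR): P\xrightarrow{\bar\jmath}Q\xrightarrow{\bar\phi}R$ be a group extension, let $\theta:Q\to\mathrm{Out}(K)$ be an outer action, and let $(KNP,PQR,\Theta)$ be an iterated extension problem, where $(KNP): K\xrightarrow{i_0}N\xrightarrow{\pi_0}P$. Then the canonical isomorphism $$-\star: H^1(P,Z(K))\xrightarrow{\ \simeq\ }\mathrm{Out}(KNP;K),$$ induced by $\lambda\mapsto\lambda\star:=\bigl(n\mapsto\lambda(\pi_0(n))\cdot n\bigr)$ for $\lambda\in Z^1(P,Z(K))$, restricts to an isomorphism $$-\star: H^1(P,Z(K))^R\xrightarrow{\ \simeq\ }\mathrm{Out}_\Theta(KNP;K)\ \subseteq\ \mathrm{Out}(N;K).$$
   Context: Conventions. For a group $H$ and an $H$-module $A$ (written multiplicatively), cochains are normalized (trivial value whenever an argument is the identity); $Z^1(H,A)$ is the group of maps $\lambda$ with $\lambda(h_1h_2)=\lambda(h_1)\cdot{}^{h_1}\lambda(h_2)$, $B^1(H,A)=\{\partial a: h\mapsto a^{-1}\cdot{}^{h}a\}$, $H^1=Z^1/B^1$. Extensions. An extension of $K$ by $P$ is a triple $(N,i_0,\pi_0)$ with $i_0:K\to N$ an injective homomorphism, $\pi_0:N\to P$ a surjective homomorphism, $i_0(K)=\mathrm{Ker}(\pi_0)$; $K$ is identified with $i_0(K)$, and $P$ with the normal subgroup $\bar\jmath(P)$ of $Q$. Conjugation of $N$ on $K$ induces a homomorphism $P\to\mathrm{Out}(K)=\mathrm{Aut}(K)/\mathrm{Inn}(K)$,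 the outer action of the extension. $Q$ acts on $Z(K)$ via $\theta$; $\theta|_P:=\theta\circ\bar\jmath$. Action of $R$ on $H^1(P,Z(K))$: for $r\in R$ and $\lambda\in Z^1(P,Z(K))$, ${}^r[\lambda]=[{}^q\lambda]$ for any $q\in Q$ with $\bar\phi(q)=r$, where ${}^q\lambda(p)={}^{\theta(q)}\lambda(q^{-1}pq)$. Mod-$K$ outer actions. $\mathrm{Aut}_K(N)$ is the group of automorphisms $\eta$ of $N$ with $\eta(K)=K$; $\complement_N(K)$ is the normal subgroup of inner automorphisms by elements of $K$; $\mathrm{Out}(N;K):=\mathrm{Aut}_K(N)/\complement_N(K)$. There are canonical homomorphisms $\mathrm{Out}(N;K)\to\mathrm{Out}(K)$ and $\mathrm{Out}(N;K)\to\mathrm{Aut}(P)$. The mod-$K$ outer action of $(KNP)$ is the homomorphism $\Theta_P:P\to\mathrm{Out}(N;K)$ induced by conjugation of $N$ on itself. A $(\theta,\complement_P^Q)$-prolongation of $\Theta_P$ is a homomorphism $\Theta:Q\to\mathrm{Out}(N;K)$ with $\Theta\circ\bar\jmath=\Theta_P$ whose composites with $\mathrm{Out}(N;K)\to\mathrm{Out}(K)$ and $\mathrm{Out}(N;K)\to\mathrm{Aut}(P)$ are $\theta$ and the conjugation action $\complement_P^Q:Q\to\mathrm{Aut}(P)$ respectively. An iterated extension problem $(KNP,PQR,\Theta)$ consists of group extensions $(KNP)$, $(PQR)$ such that $(KNP)$ has outer action $\theta|_P$, and a $(\theta,\complement_P^Q)$-prolongation $\Theta$ of $\Theta_P$.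 Automorphisms. $\mathrm{Aut}(KNP):=\{\eta\in\mathrm{Aut}(N):\eta\circ i_0=i_0,\ \pi_0\circ\eta=\pi_0\}$; $\mathrm{Out}(KNP;K)$ is its image in $\mathrm{Out}(N;K)$. An automorphism $\eta\in\mathrm{Aut}_K(N)$ is $\Theta$-compatible if its image $\bar\eta\in\mathrm{Out}(N;K)$ commutes with $\Theta(q)$ for all $q\in Q$. $\mathrm{Aut}_\Theta(KNP)$ is the group of $\Theta$-compatible $\eta\in\mathrm{Aut}(KNP)$ and $\mathrm{Out}_\Theta(KNP;K)$ is its image in $\mathrm{Out}(N;K)$. *)

(* Defs.v *)
(* MathComp groupType: groups need not be finite. Choice structures, coset
   representatives and preimages come from the classical axioms of boolp. *)
From HB Require Import structures.
From mathcomp Require Import all_boot.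
From mathcomp Require Export monoid.
From mathcomp Require Export boolp.

Set Implicit Arguments.
Unset Strict Implicit.
Unset Printing Implicit Defensive.

Local Open Scope group_scope.
Local Open Scope quotient_scope.

Section MkGroup.
Variables (G : groupType) (S : {pred G}) (hS : group_closed S).
Definition mkgroup : groupClosed G :=
  HB.pack_for (groupClosed G) S
    (isMul1Closed.Build G S (proj1 hS))
    (isInvClosed.Build G S (group_closedV hS))
    (isMulClosed.Build G S (group_closedM hS)).
End MkGroup.

Record subg (G : groupType) (S : groupClosed G) := Subg {
  sgval :> G;
  sgvalP : sgval \in S
}.

Section SubgGroup.
Variables (G : groupType) (S : groupClosed G).
HB.instance Definition _ := [isSub for @sgval G S].
HB.instance Definition _ := [Choice of subg S by <:].
Fact subg_closed : group_closed S.
Proof. by split; [exact: gpred1 | move=> x y; exact: gpredF]. Qed.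
HB.instance Definition _ :=
  SubChoice_isSubGroup.Build G (fun x => x \in S) (subg S) subg_closed.
End SubgGroup.

Record normalSubgroup (G : groupType) := NormalSubgroup {
  nsg :> groupClosed G;
  nsgJ : forall x y : G, x \in nsg -> x ^ y \in nsg
}.

Section Quotient.
Variables (G : groupType) (S : normalSubgroup G).
Implicit Types x y : G.

Definition qeqv x y := x^-1 * y \in S.

Fact qeqv_refl : reflexive qeqv.
Proof. by move=> x; rewrite /qeqv mulVg gpred1. Qed.
Fact qeqv_sym : symmetric qeqv.
Proof. by move=> x y; rewrite /qeqv -gpredV invgM invgK. Qed.
Fact qeqv_trans : transitive qeqv.
Proof.
move=> y x z; rewrite /qeqv => Hxy Hyz.
by rewrite -(mulVKg y z) mulgA; apply: gpredM.
Qed.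

Canonical qeqv_equiv := EquivRel qeqv qeqv_refl qeqv_sym qeqv_trans.

Definition quotg := {eq_quot qeqv}.
HB.instance Definition _ := Choice.on quotg.
HB.instance Definition _ := EqQuotient.on quotg.

Definition cls (x : G) : quotg := \pi_quotg x.

Lemma clsP x y : cls x = cls y <-> x^-1 * y \in S.
Proof. by split => [/eqmodP|H]; [|apply/eqmodP]. Qed.

Lemma cls_repr (c : quotg) : cls (repr c) = c. Proof. exact: reprK. Qed.

Lemma cls_surj (c : quotg) : exists x, cls x = c.
Proof. by exists (repr c); rewrite cls_repr. Qed.

Lemma repr_cls x : exists2 s, s \in S & repr (cls x) = x * s.
Proof.
exists (x^-1 * repr (cls x)); last by rewrite mulVKg.
by apply/clsP; rewrite cls_repr.
Qed.

Definition quotg_one : quotg := cls 1.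
Definition quotg_inv (c : quotg) : quotg := cls (repr c)^-1.
Definition quotg_mul (c d : quotg) : quotg := cls (repr c * repr d).

Lemma quotg_mulE x y : quotg_mul (cls x) (cls y) = cls (x * y).
Proof.
rewrite /quotg_mul; have [s Ss ->] := repr_cls x; have [t St ->] := repr_cls y.
apply/esym/clsP.
have -> : (x * y)^-1 * (x * s * (y * t)) = s ^ y * t.
  by rewrite /conjg invgM !mulgA mulgVK.
by apply: gpredM => //; apply: nsgJ.
Qed.

Lemma quotg_invE x : quotg_inv (cls x) = cls x^-1.
Proof.
rewrite /quotg_inv; have [s Ss ->] := repr_cls x.
apply/clsP; rewrite invgK.
have -> : x * s * x^-1 = s ^ x^-1 by rewrite /conjg invgK mulgA.
exact: nsgJ.
Qed.

Fact quotg_mulA : associative quotg_mul.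
Proof.
move=> c d e; rewrite -(cls_repr c) -(cls_repr d) -(cls_repr e).
by rewrite !quotg_mulE mulgA.
Qed.
Fact quotg_mul1 : left_id quotg_one quotg_mul.
Proof. by move=> c; rewrite -(cls_repr c) quotg_mulE mul1g. Qed.
Fact quotg_mulr1 : right_id quotg_one quotg_mul.
Proof. by move=> c; rewrite -(cls_repr c) quotg_mulE mulg1. Qed.
Fact quotg_mulV : left_inverse quotg_one quotg_inv quotg_mul.
Proof. by move=> c; rewrite -(cls_repr c) quotg_invE quotg_mulE mulVg. Qed.
Fact quotg_mulrV : right_inverse quotg_one quotg_inv quotg_mul.
Proof. by move=> c; rewrite -(cls_repr c) quotg_invE quotg_mulE mulgV. Qed.

HB.instance Definition _ :=
  isGroup.Build quotg quotg_mulA quotg_mul1 quotg_mulr1 quotg_mulV quotg_mulrV.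

Fact clsM : {morph cls : x y / x * y}.
Proof. by move=> x y; exact/esym/quotg_mulE. Qed.
HB.instance Definition _ := isMultiplicative.Build G quotg cls clsM.
End Quotient.

Section Image.
Variables (G H : groupType) (f : {multiplicative G -> H}) (S : groupClosed G).

Lemma mulf1 : f 1 = 1.
Proof. by apply: (mulgI (f 1)); rewrite -gmulfM !mulg1. Qed.

Lemma mulfV x : f x^-1 = (f x)^-1.
Proof. by apply: (mulgI (f x)); rewrite -gmulfM !mulgV mulf1. Qed.

Fact img_closed : group_closed [pred y | `[< exists2 x, x \in S & f x = y >]].
Proof.
split; first by apply/asboolP; exists 1; [exact: gpred1 | exact: mulf1].
move=> _ _ /asboolP[x Sx <-] /asboolP[y Sy <-]; apply/asboolP.
by exists (x * y^-1); [exact: gpredF | rewrite gmulfM mulfV].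
Qed.

Definition imgroup : groupClosed H := mkgroup img_closed.
End Image.

(* The product of Aut G is composition, (a * b) x = a (b x), so that left      *)
(* conjugation x |-> g x g^-1 (and not mathcomp's x ^ g) is a homomorphism in g. *)
Record Aut (G : groupType) := MkAut {
  aut_fun :> G -> G;
  _ : `[< {morph aut_fun : x y / x * y} /\ bijective aut_fun >]
}.
HB.instance Definition _ G := [isSub for @aut_fun G].
HB.instance Definition _ G := [Choice of Aut G by <:].

Section AutGroup.
Variable G : groupType.
Implicit Types a b : Aut G.

Lemma autM a : {morph a : x y / x * y}.
Proof. by case: a => f /= /asboolP[]. Qed.

Lemma aut_bij a : bijective a.
Proof. by case: a => f /= /asboolP[]. Qed.

HB.instance Definition _ a := isMultiplicative.Build G G a (autM a).

Lemma autP a b : a =1 b -> a = b.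
Proof. by move=> eq_ab; apply/val_inj/funext. Qed.

Definition aut_of (f : G -> G) (fM : {morph f : x y / x * y})
  (fB : bijective f) : Aut G := MkAut (introT (asboolP _) (conj fM fB)).

Fact aut_inv_exists a : exists g : G -> G, cancel a g /\ cancel g a.
Proof. by case: (aut_bij a) => g; exists g. Qed.

Definition aut_invf a : G -> G := sval (cid (aut_inv_exists a)).
Lemma aut_invfK a : cancel a (aut_invf a).
Proof. by rewrite /aut_invf; case: cid => g []. Qed.
Lemma aut_invfKV a : cancel (aut_invf a) a.
Proof. by rewrite /aut_invf; case: cid => g []. Qed.

Fact aut_invM a : {morph aut_invf a : x y / x * y}.
Proof.
move=> x y; apply: (can_inj (aut_invfK a)).
by rewrite autM !aut_invfKV.
Qed.

Fact aut_compM a b : {morph a \o b : x y / x * y}.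
Proof. by move=> x y /=; rewrite !autM. Qed.

Definition aut_one : Aut G := aut_of (f := id) (fun _ _ => erefl)
  (Bijective (g := id) (fun=> erefl) (fun=> erefl)).
Definition aut_mul a b : Aut G :=
  aut_of (aut_compM a b) (bij_comp (aut_bij a) (aut_bij b)).
Definition aut_inv a : Aut G :=
  aut_of (@aut_invM a) (Bijective (aut_invfKV a) (aut_invfK a)).

Fact aut_mulA : associative aut_mul. Proof. by move=> a b c; exact: autP. Qed.
Fact aut_mul1 : left_id aut_one aut_mul. Proof. by move=> a; exact: autP. Qed.
Fact aut_mulr1 : right_id aut_one aut_mul. Proof. by move=> a; exact: autP. Qed.
Fact aut_mulV : left_inverse aut_one aut_inv aut_mul.
Proof. by move=> a; apply: autP => x /=; rewrite aut_invfK. Qed.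
Fact aut_mulrV : right_inverse aut_one aut_inv aut_mul.
Proof. by move=> a; apply: autP => x /=; rewrite aut_invfKV. Qed.
HB.instance Definition _ :=
  isGroup.Build (Aut G) aut_mulA aut_mul1 aut_mulr1 aut_mulV aut_mulrV.

Lemma autME a b x : (a * b) x = a (b x). Proof. by []. Qed.
Lemma aut1E x : (1 : Aut G) x = x. Proof. by []. Qed.
Lemma autVK a x : a^-1 (a x) = x. Proof. exact: aut_invfK. Qed.
Lemma autKV a x : a (a^-1 x) = x. Proof. exact: aut_invfKV. Qed.

Definition conjl (g x : G) : G := g * x * g^-1.

Fact conjlM g : {morph conjl g : x y / x * y}.
Proof. by move=> x y; rewrite /conjl !mulgA mulgVK. Qed.
Fact conjl_bij g : bijective (conjl g).
Proof.
by exists (conjl g^-1) => x; rewrite /conjl invgK !mulgA ?mulVg ?mulgV mul1g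
  ?mulgK ?mulgVK.
Qed.
Definition inner (g : G) : Aut G := aut_of (conjlM g) (conjl_bij g).

Fact innerM : {morph inner : g h / g * h}.
Proof. by move=> g h; apply: autP => x /=; rewrite /conjl invgM !mulgA. Qed.
HB.instance Definition _ := isMultiplicative.Build G (Aut G) inner innerM.

Lemma inner_aut a g : a * inner g * a^-1 = inner (a g).
Proof.
apply: autP => x; rewrite !autME /= /conjl !autM autKV.
by rewrite (mulfV a).
Qed.

Fact Inn_closed : group_closed [pred a : Aut G | `[< exists g, inner g = a >]].
Proof.
split; first by apply/asboolP; exists 1; exact: mulf1.
move=> _ _ /asboolP[g <-] /asboolP[h <-]; apply/asboolP; exists (g * h^-1).
by rewrite gmulfM mulfV.
Qed.
Fact Inn_normal a b : a \in mkgroup Inn_closed -> a ^ b \in mkgroup Inn_closed.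
Proof.
move=> /asboolP[g <-]; apply/asboolP; exists (b^-1 g).
by rewrite -inner_aut invgK /conjg mulgA.
Qed.
Definition Inn : normalSubgroup (Aut G) := NormalSubgroup Inn_normal.
Definition Out : groupType := quotg Inn.
End AutGroup.

Record extension (K N P : groupType) := Extension {
  inc : {multiplicative K -> N};
  prj : {multiplicative N -> P};
  inc_inj : injective inc;
  prj_surj : forall p, exists n, prj n = p;
  ext_exact : forall n, (exists k, inc k = n) <-> prj n = 1
}.

Section Extension.
Variables (K N P : groupType) (E : extension K N P).
Local Notation i := (inc E).
Local Notation pi := (prj E).

Definition lft (p : P) : N := sval (cid (prj_surj E p)).
Lemma lftK p : pi (lft p) = p. Proof. by rewrite /lft; case: cid. Qed.

Lemma prj_inc k : pi (i k) = 1. Proof. by apply/ext_exact; exists k. Qed.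

Lemma prj_eq n m : pi n = pi m -> exists k, n = i k * m.
Proof.
move=> eq_nm; have /ext_exact[k ik] : pi (n * m^-1) = 1.
  by rewrite gmulfM mulfV eq_nm mulgV.
by exists k; rewrite ik mulgVK.
Qed.

(* eta(K) = K, as an equality of subsets of N. *)
Definition preservesK (eta : Aut N) :=
  forall n, (exists k, i k = n) <-> (exists k, eta (i k) = n).

Fact AutK_closed : group_closed [pred eta : Aut N | `[< preservesK eta >]].
Proof.
split; first exact/asboolP.
move=> a b /asboolP Ka /asboolP Kb; apply/asboolP => n.
have Va : preservesK a <-> forall m, (exists k, i k = a m) <-> (exists k, i k = m).
  split=> H m.
    rewrite H; split=> -[k]; first by move/(can_inj (autVK a)); exists k.
    by move=> <-; exists k.
  rewrite -{1}(autKV a m) H; split=> -[k].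
    by move=> e; exists k; rewrite e autKV.
  by move=> <-; exists k; rewrite autVK.
have Vb m : (exists k, i k = b m) <-> (exists k, i k = m).
  rewrite Kb; split=> -[k]; first by move/(can_inj (autVK b)); exists k.
  by move=> <-; exists k.
move/Va: Ka => Ka; split.
  move=> [k <-]; have [] : exists k', i k' = b (a^-1 (i k)).
    by apply/Vb/Ka; rewrite autKV; exists k.
  move=> k' e; exists k'; rewrite autME e autVK; exact: autKV.
move=> [k <-]; rewrite autME; apply/Ka/Vb; rewrite autKV; by exists k.
Qed.
Definition AutK_set : groupClosed (Aut N) := mkgroup AutK_closed.
Definition AutK : Type := subg AutK_set.
HB.instance Definition _ := Group.on AutK.
Coercion AutK_aut (a : AutK) : Aut N := sgval a.

Lemma AutK_inc (a : AutK) k : exists k', i k' = a (i k).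
Proof. by case: a => a /= /asboolP Ka; apply/Ka; exists k. Qed.

Lemma AutK_incV (a : AutK) k : exists k', a (i k') = i k.
Proof. by case: a => a /= /asboolP Ka; apply/Ka; exists k. Qed.

Lemma AutKME (a b : AutK) n : (a * b : AutK) n = a (b n). Proof. by []. Qed.
Lemma AutKVK (a : AutK) n : (a^-1 : AutK) (a n) = n.
Proof. exact: (autVK (sgval a)). Qed.
Lemma AutKKV (a : AutK) n : a ((a^-1 : AutK) n) = n.
Proof. exact: (autKV (sgval a)). Qed.

Fact inner_AutK n : inner n \in AutK_set.
Proof.
apply/asboolP => m; rewrite ext_exact; split.
  move=> m1; have /ext_exact[k ik] : pi (conjl n^-1 m) = 1.
    by rewrite /conjl !gmulfM m1 mulg1 -gmulfM mulgV mulf1.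
  by exists k; rewrite ik /= /conjl invgK !mulgA mulgV mul1g mulgK.
by move=> [k <-]; rewrite /= /conjl !gmulfM prj_inc mulg1 -gmulfM mulgV mulf1.
Qed.
Definition innerK (n : N) : AutK := Subg (inner_AutK n).
Fact innerKM : {morph innerK : g h / g * h}.
Proof. by move=> g h; apply: val_inj; rewrite /= gmulfM. Qed.
HB.instance Definition _ := isMultiplicative.Build N AutK innerK innerKM.

Fact cmplK_closed :
  group_closed [pred a : AutK | `[< exists k, innerK (i k) = a >]].
Proof.
split; first by apply/asboolP; exists 1; rewrite !mulf1.
move=> _ _ /asboolP[g <-] /asboolP[h <-]; apply/asboolP; exists (g * h^-1).
by rewrite !gmulfM !mulfV.
Qed.
Fact cmplK_normal (a b : AutK) :
  a \in mkgroup cmplK_closed -> a ^ b \in mkgroup cmplK_closed.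
Proof.
move=> /asboolP[k <-]; apply/asboolP; have [k' e] := AutK_inc b^-1 k.
exists k'; apply: val_inj; rewrite /= e -[X in inner X]/((sgval b)^-1 (i k)).
by rewrite -inner_aut invgK /conjg mulgA.
Qed.
Definition cmplK : normalSubgroup AutK := NormalSubgroup cmplK_normal.
Definition OutK : groupType := quotg cmplK.

Section Restrict.
Variable a : AutK.
Definition res_fun (k : K) : K := sval (cid (AutK_inc a k)).
Lemma res_funE k : i (res_fun k) = a (i k).
Proof. by rewrite /res_fun; case: cid. Qed.
Fact res_funM : {morph res_fun : x y / x * y}.
Proof.
by move=> x y; apply: (@inc_inj _ _ _ E); rewrite !(gmulfM, res_funE).
Qed.
Fact res_bij : bijective res_fun.
Proof.
have /choice[g gE] := AutK_incV a.
exists g => k; apply: (@inc_inj _ _ _ E); last by rewrite res_funE gE.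
by apply: (can_inj (AutKVK a)); rewrite gE res_funE.
Qed.
Definition res : Aut K := aut_of res_funM res_bij.
Lemma resE k : i (res k) = a (i k). Proof. exact: res_funE. Qed.
End Restrict.

Fact resM : {morph res : a b / a * b}.
Proof.
move=> a b; apply: autP => k; apply: (@inc_inj _ _ _ E).
by rewrite autME !resE.
Qed.
HB.instance Definition _ := isMultiplicative.Build AutK (Aut K) res resM.

Lemma AutK_prj (a : AutK) n m : pi n = pi m -> pi (a n) = pi (a m).
Proof.
move=> /prj_eq[k ->]; have [k' e] := AutK_inc a k.
by rewrite autM -e gmulfM prj_inc mul1g.
Qed.

Definition ind_fun (a : AutK) (p : P) : P := pi (a (lft p)).
Lemma ind_funE a n : ind_fun a (pi n) = pi (a n).
Proof. by apply: AutK_prj; rewrite lftK. Qed.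
Fact ind_funM a : {morph ind_fun a : x y / x * y}.
Proof.
move=> x y; rewrite -(lftK x) -(lftK y) -gmulfM !ind_funE.
by rewrite autM gmulfM.
Qed.
Fact ind_bij a : bijective (ind_fun a).
Proof.
by exists (ind_fun a^-1) => p; rewrite -(lftK p) !ind_funE ?AutKVK ?AutKKV.
Qed.
Definition ind (a : AutK) : Aut P := aut_of (@ind_funM a) (@ind_bij a).
Lemma indE a n : ind a (pi n) = pi (a n). Proof. exact: ind_funE. Qed.
Fact indM : {morph ind : a b / a * b}.
Proof. by move=> a b; apply: autP => p; rewrite -(lftK p) autME !indE. Qed.
HB.instance Definition _ := isMultiplicative.Build AutK (Aut P) ind indM.

(* The canonical homomorphisms Out(N;K) -> Out(K) and Out(N;K) -> Aut(P);     *)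
(* the lemmas show independence of the representative.                        *)
Definition OutK_Out (c : OutK) : Out K := cls (Inn K) (res (repr c)).
Definition OutK_Aut (c : OutK) : Aut P := ind (repr c).

Lemma res_innerK k : res (innerK (i k)) = inner k.
Proof.
apply: autP => x; apply: (@inc_inj _ _ _ E).
by rewrite resE /= /conjl !gmulfM mulfV.
Qed.
Lemma ind_innerK k : ind (innerK (i k)) = 1.
Proof.
apply: autP => p; rewrite -(lftK p) indE /= /conjl !gmulfM mulfV prj_inc.
by rewrite mul1g invg1 mulg1.
Qed.

Lemma OutK_OutE a : OutK_Out (cls cmplK a) = cls (Inn K) (res a).
Proof.
rewrite /OutK_Out; have [_ /asboolP[k <-] ->] := repr_cls cmplK a.
apply/esym/clsP; rewrite resM mulKg res_innerK.
by apply/asboolP; exists k.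
Qed.
Lemma OutK_AutE a : OutK_Aut (cls cmplK a) = ind a.
Proof.
rewrite /OutK_Aut; have [_ /asboolP[k <-] ->] := repr_cls cmplK a.
by rewrite indM ind_innerK mulg1.
Qed.

Fact OutK_OutM : {morph OutK_Out : c d / c * d}.
Proof.
move=> c d; rewrite -(cls_repr c) -(cls_repr d) -clsM !OutK_OutE.
by rewrite resM clsM.
Qed.
Fact OutK_AutM : {morph OutK_Aut : c d / c * d}.
Proof.
move=> c d; rewrite -(cls_repr c) -(cls_repr d) -clsM !OutK_AutE.
by rewrite indM.
Qed.
HB.instance Definition _ := isMultiplicative.Build OutK (Out K) OutK_Out OutK_OutM.
HB.instance Definition _ := isMultiplicative.Build OutK (Aut P) OutK_Aut OutK_AutM.

(* The mod-K outer action and the outer action of the extension, both induced *)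
(* by conjugation of N.                                                       *)
Definition modK_outer_action (p : P) : OutK := cls cmplK (innerK (lft p)).
Definition outer_action (p : P) : Out K := cls (Inn K) (res (innerK (lft p))).

Lemma modK_outer_actionE n : modK_outer_action (pi n) = cls cmplK (innerK n).
Proof.
rewrite /modK_outer_action; have [k ->] : exists k, lft (pi n) = i k * n.
  by apply: prj_eq; rewrite lftK.
have -> : i k * n = n * conjl n^-1 (i k).
  by rewrite /conjl invgK !mulgA mulgV mul1g.
have [k' e] := AutK_inc (innerK n^-1) k.
rewrite -[conjl _ _]e.
rewrite innerKM; apply/esym/clsP; rewrite mulKg.
by apply/asboolP; exists k'.
Qed.

Lemma outer_action_OutK p : outer_action p = OutK_Out (modK_outer_action p).
Proof. by rewrite OutK_OutE. Qed.

Lemma outer_actionE n : outer_action (pi n) = cls (Inn K) (res (innerK n)).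
Proof. by rewrite outer_action_OutK modK_outer_actionE OutK_OutE. Qed.

Fact modK_outer_actionM : {morph modK_outer_action : x y / x * y}.
Proof.
move=> x y; rewrite -(lftK x) -(lftK y) -gmulfM !modK_outer_actionE.
by rewrite innerKM clsM.
Qed.
HB.instance Definition _ :=
  isMultiplicative.Build P OutK modK_outer_action modK_outer_actionM.
Fact outer_actionM : {morph outer_action : x y / x * y}.
Proof. by move=> x y; rewrite !outer_action_OutK modK_outer_actionM OutK_OutM. Qed.
HB.instance Definition _ :=
  isMultiplicative.Build P (Out K) outer_action outer_actionM.
End Extension.

(* The action of the total group of an extension P -> Q -> R on P by          *)
(* conjugation.                                                               *)
Definition conj_action (P Q R : groupType) (E : extension P Q R) (q : Q) : Aut P :=
  res (innerK E q).

Lemma conj_actionE (P Q R : groupType) (E : extension P Q R) q p :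
  inc E (conj_action E q p) = q * inc E p * q^-1.
Proof. exact: resE. Qed.

Lemma conj_actionM (P Q R : groupType) (E : extension P Q R) :
  {morph conj_action E : q q' / q * q'}.
Proof. by move=> q q'; rewrite /conj_action innerKM resM. Qed.

Record gmodule (H A : groupType) := GModule {
  gact :> H -> A -> A;
  gact1 : forall a, gact 1 a = a;
  gactM : forall h h' a, gact (h * h') a = gact h (gact h' a);
  gact_morph : forall h, {morph gact h : a b / a * b};
  gmod_comm : forall a b : A, a * b = b * a
}.

Definition res_module (P Q A : groupType) (f : {multiplicative P -> Q})
  (M : gmodule Q A) : gmodule P A.
Proof.
apply: (@GModule P A (fun p => M (f p))) => [a|p p' a|p|a b].
- by rewrite mulf1 gact1.
- by rewrite gmulfM gactM.
- exact: gact_morph.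
- exact: gmod_comm M a b.
Defined.

Section Cochain.
Variables (H A : groupType).
Definition cochain : Type := H -> A.
HB.instance Definition _ := Choice.copy cochain (H -> A).
Implicit Types l m : cochain.
Definition cochain_one : cochain := fun=> 1.
Definition cochain_inv l : cochain := fun h => (l h)^-1.
Definition cochain_mul l m : cochain := fun h => l h * m h.
Fact cochain_mulA : associative cochain_mul.
Proof. by move=> l m n; apply/funext => h; exact: mulgA. Qed.
Fact cochain_mul1 : left_id cochain_one cochain_mul.
Proof. by move=> l; apply/funext => h; exact: mul1g. Qed.
Fact cochain_mulr1 : right_id cochain_one cochain_mul.
Proof. by move=> l; apply/funext => h; exact: mulg1. Qed.
Fact cochain_mulV : left_inverse cochain_one cochain_inv cochain_mul.
Proof. by move=> l; apply/funext => h; exact: mulVg. Qed.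
Fact cochain_mulrV : right_inverse cochain_one cochain_inv cochain_mul.
Proof. by move=> l; apply/funext => h; exact: mulgV. Qed.
HB.instance Definition _ := isGroup.Build cochain
  cochain_mulA cochain_mul1 cochain_mulr1 cochain_mulV cochain_mulrV.
End Cochain.

Section Cohomology.
Variables (H A : groupType) (M : gmodule H A).

Lemma gact_one h : M h 1 = 1.
Proof. by apply: (mulgI (M h 1)); rewrite -gact_morph !mulg1. Qed.
Lemma gactV h a : M h a^-1 = (M h a)^-1.
Proof. by apply: (mulgI (M h a)); rewrite -gact_morph !mulgV gact_one. Qed.
Lemma gmodCA (a b c d : A) : a * b * (c * d) = a * c * (b * d).
Proof. by rewrite !mulgA -[a * b * c]mulgA (gmod_comm M b c) mulgA. Qed.

(* Cocycles are automatically normalized, see cocycle1.                       *)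
Definition cocycle (l : cochain H A) := forall h h', l (h * h') = l h * M h (l h').

Fact Z1_closed : group_closed [pred l : cochain H A | `[< cocycle l >]].
Proof.
split; first by apply/asboolP => h h'; rewrite /= gact_one mulg1.
move=> l m /asboolP Zl /asboolP Zm; apply/asboolP => h h'.
rewrite -[LHS]/(l (h * h') * (m (h * h'))^-1) -[(l / m) h']/(l h' * (m h')^-1).
rewrite -[(l / m) h]/(l h * (m h)^-1) Zl Zm gact_morph gactV.
by rewrite invgM [(M h _)^-1 * _](gmod_comm M) gmodCA.
Qed.
Definition Z1_set : groupClosed (cochain H A) := mkgroup Z1_closed.
Definition Z1 : Type := subg Z1_set.
HB.instance Definition _ := Group.on Z1.
Definition Z1_fun (l : Z1) : H -> A := sgval l.
Coercion Z1_fun : Z1 >-> Funclass.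

Definition mkZ1 (l : cochain H A) (Zl : cocycle l) : Z1 :=
  @Subg _ Z1_set l (introT (asboolP _) Zl).

Lemma Z1P (l m : Z1) : l =1 m -> l = m.
Proof. by move=> e; apply/val_inj/funext. Qed.
Lemma Z1E (l : Z1) : cocycle l.
Proof. by case: l => l /= /asboolP. Qed.
Lemma Z1ME (l m : Z1) h : (l * m : Z1) h = l h * m h. Proof. by []. Qed.
Lemma Z1VE (l : Z1) h : (l^-1 : Z1) h = (l h)^-1. Proof. by []. Qed.
Lemma Z1_comm (l m : Z1) : l * m = m * l.
Proof. by apply: Z1P => h; rewrite !Z1ME (gmod_comm M). Qed.
Lemma cocycle1 (l : Z1) : l 1 = 1.
Proof. by apply: (mulgI (l 1)); have := Z1E l 1 1; rewrite gact1 !mulg1. Qed.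

Definition cobound (a : A) : cochain H A := fun h => a^-1 * M h a.

Fact B1_closed :
  group_closed [pred l : Z1 | `[< exists a, (l : Z1) =1 cobound a >]].
Proof.
split; first by apply/asboolP; exists 1 => h; rewrite /cobound gact_one mulg1 invg1.
move=> l m /asboolP[a la] /asboolP[b mb]; apply/asboolP; exists (a * b^-1) => h.
rewrite -[LHS]/((l : Z1) h * ((m : Z1) h)^-1) la mb /cobound gact_morph gactV !invgM.
by rewrite [(M h b)^-1 * _](gmod_comm M) gmodCA [a^-1 * _](gmod_comm M).
Qed.
Fact B1_normal (l m : Z1) : l \in mkgroup B1_closed -> l ^ m \in mkgroup B1_closed.
Proof. by rewrite /conjg Z1_comm mulgK. Qed.
Definition B1 : normalSubgroup Z1 := NormalSubgroup B1_normal.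
Definition H1 : groupType := quotg B1.
End Cohomology.

Section ActionH1.
Variables (P Q R A : groupType) (E : extension P Q R) (M : gmodule Q A).
Local Notation MP := (res_module (inc E) M).

Fact conj_cocycle (q : Q) (l : Z1 MP) :
  cocycle MP (fun p => M q (l (conj_action E q^-1 p))).
Proof.
move=> h h'; rewrite autM Z1E gact_morph; congr (_ * _).
by rewrite /= -!gactM conj_actionE invgK !mulgA mulgV mul1g.
Qed.

(* (^q l)(p) = ^{theta(q)} l(q^-1 p q) *)
Definition conjZ1 (q : Q) (l : Z1 MP) : Z1 MP := mkZ1 (@conj_cocycle q l).

Definition actH1 (r : R) (c : H1 MP) : H1 MP :=
  cls (B1 MP) (conjZ1 (lft E r) (repr c)).

Lemma conjZ1M q : {morph conjZ1 q : l m / l * m}.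
Proof. by move=> l m; apply: Z1P => p; exact: gact_morph. Qed.
Lemma conjZ1_mul q q' l : conjZ1 (q * q') l = conjZ1 q (conjZ1 q' l).
Proof.
apply: Z1P => p.
rewrite -[LHS]/(M (q * q') (l (conj_action E (q * q')^-1 p))).
by rewrite gactM invgM conj_actionM.
Qed.

Lemma conjZ1_B1 q l : l \in B1 MP -> conjZ1 q l \in B1 MP.
Proof.
move=> /asboolP[a la]; apply/asboolP; exists (M q a) => p.
rewrite -[LHS]/(M q ((l : Z1 MP) (conj_action E q^-1 p))) la /cobound.
rewrite gact_morph gactV /= -!gactM.
by rewrite conj_actionE invgK !mulgA mulgV mul1g.
Qed.

Lemma conjZ1_inc p l : cls (B1 MP) (conjZ1 (inc E p) l) = cls (B1 MP) l.
Proof.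
apply/esym/clsP/asboolP; exists (l p) => x.
rewrite -[LHS]/((l x)^-1 * M (inc E p) (l (conj_action E (inc E p)^-1 x))).
have -> : conj_action E (inc E p)^-1 x = p^-1 * (x * p).
  apply: (@inc_inj _ _ _ E).
  by rewrite conj_actionE invgK !gmulfM mulfV mulgA.
have lV : M (inc E p) (l p^-1) = (l p)^-1.
  by apply: (mulgI (l p)); rewrite mulgV -(cocycle1 l) -(mulgV p) (Z1E l p p^-1).
rewrite Z1E gact_morph lV /= -gactM mulfV mulgV gact1 (Z1E l x p) /=.
by rewrite /cobound mulgA [_ * (l p)^-1](gmod_comm M) -mulgA mulKg.
Qed.

Lemma actH1_cls (q : Q) (l : Z1 MP) :
  actH1 (prj E q) (cls (B1 MP) l) = cls (B1 MP) (conjZ1 q l).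
Proof.
rewrite /actH1; have [b Bb ->] := repr_cls (B1 MP) l.
have [p ->] : exists p, lft E (prj E q) = inc E p * q.
  by apply: prj_eq; rewrite lftK.
rewrite conjZ1_mul conjZ1_inc conjZ1M; apply/esym/clsP; rewrite mulKg.
exact: conjZ1_B1.
Qed.

Lemma actH1_one c : actH1 1 c = c.
Proof.
rewrite -(cls_repr c) -[X in actH1 X _](mulf1 (prj E)) actH1_cls.
by rewrite -(mulf1 (inc E)) conjZ1_inc.
Qed.

Lemma actH1_mul r r' c : actH1 (r * r') c = actH1 r (actH1 r' c).
Proof.
rewrite -(cls_repr c) -(lftK E r) -(lftK E r') -gmulfM !actH1_cls.
by rewrite conjZ1_mul.
Qed.

Fact actH1M r : {morph actH1 r : c d / c * d}.
Proof.
move=> c d; rewrite -(cls_repr c) -(cls_repr d) -clsM -(lftK E r) !actH1_cls.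
by rewrite conjZ1M clsM.
Qed.
HB.instance Definition _ r := isMultiplicative.Build (H1 MP) (H1 MP) (actH1 r) (actH1M r).

Fact H1_inv_closed : group_closed [pred c : H1 MP | `[< forall r, actH1 r c = c >]].
Proof.
split; first by apply/asboolP => r; exact: mulf1.
move=> c d /asboolP Ic /asboolP Id; apply/asboolP => r.
have -> : actH1 r (c / d) = actH1 r c / actH1 r d.
  by rewrite actH1M; congr (_ * _); exact: mulfV.
by rewrite Ic Id.
Qed.
Definition H1_inv : groupClosed (H1 MP) := mkgroup H1_inv_closed.
End ActionH1.

Section Center.
Variable K : groupType.

Fact center_closed : group_closed [pred z : K | `[< forall k, commute z k >]].
Proof.
split; first by apply/asboolP => k; exact: commute_sym (commute1 _).
move=> x y /asboolP Zx /asboolP Zy; apply/asboolP => k.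
apply: commute_sym; apply: commuteM; last apply: commuteV.
  exact: commute_sym.
exact: commute_sym.
Qed.
Definition center_set : groupClosed K := mkgroup center_closed.
Definition center : Type := subg center_set.
HB.instance Definition _ := Group.on center.
Coercion center_val (z : center) : K := sgval z.

Lemma centerC (z : center) (k : K) : commute (z : K) k.
Proof. by have /asboolP := sgvalP z; apply. Qed.
Lemma centerP (x y : center) : x = y :> K -> x = y.
Proof. exact: val_inj. Qed.
Lemma centerME (x y : center) : (x * y : center) = x * y :> K.
Proof. by []. Qed.

Fact aut_center_subproof (a : Aut K) (z : center) : a z \in center_set.
Proof.
apply/asboolP => k; rewrite -(autKV a k) /commute -!autM.
by congr (a _); exact: centerC.
Qed.
Definition aut_center (a : Aut K) (z : center) : center :=
  Subg (aut_center_subproof a z).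
Definition out_center (o : Out K) (z : center) : center := aut_center (repr o) z.

Lemma out_centerE a z : out_center (cls (Inn K) a) z = aut_center a z.
Proof.
apply: centerP => /=; have [_ /asboolP[k <-] ->] := repr_cls (Inn K) a.
rewrite autME /= /conjl; congr (a _).
by rewrite -(centerC z k) mulgK.
Qed.

Definition center_module (Q : groupType) (theta : {multiplicative Q -> Out K}) :
  gmodule Q center.
Proof.
apply: (@GModule Q center (fun q => out_center (theta q))).
- move=> z; rewrite mulf1 -[1]/(cls (Inn K) 1) out_centerE.
  exact: centerP.
- move=> q q' z; rewrite gmulfM -(cls_repr (theta q)) -(cls_repr (theta q')).
  by rewrite -clsM !out_centerE; exact: centerP.
- by move=> q x y; apply: centerP; rewrite /= -autM.
- by move=> x y; apply: centerP; exact: centerC.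
Defined.
End Center.

Record is_prolongation (K N P Q R : groupType) (KNP : extension K N P)
    (PQR : extension P Q R) (theta : {multiplicative Q -> Out K})
    (Theta : {multiplicative Q -> OutK KNP}) : Prop := IsProlongation {
  prolong_modK : forall p, Theta (inc PQR p) = modK_outer_action KNP p;
  prolong_Out : forall q, OutK_Out (Theta q) = theta q;
  prolong_Aut : forall q, OutK_Aut (Theta q) = conj_action PQR q
}.

Section Automorphisms.
Variables (K N P : groupType) (KNP : extension K N P).
Local Notation i0 := (inc KNP).
Local Notation pi0 := (prj KNP).
Local Notation AutN := (AutK KNP).
Local Notation OutN := (OutK KNP).

(* Aut(KNP), as a subgroup of Aut_K(N): eta o i0 = i0 forces eta(K) = K.      *)
Definition is_extension_aut (eta : Aut N) : Prop :=
  (forall k, eta (i0 k) = i0 k) /\ (forall n, pi0 (eta n) = pi0 n).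

Lemma extension_aut_preservesK eta : is_extension_aut eta -> preservesK KNP eta.
Proof. by case=> e _ n; split=> -[k <-]; exists k; rewrite e. Qed.

Fact AutKNP_closed :
  group_closed [pred eta : AutN | `[< is_extension_aut eta >]].
Proof.
split; first exact/asboolP.
move=> a b /asboolP[aK aP] /asboolP[bK bP]; apply/asboolP; split=> [k|n].
  by rewrite AutKME -[in LHS](bK k) AutKVK aK.
by rewrite AutKME aP -bP AutKKV.
Qed.
Definition AutKNP : groupClosed AutN := mkgroup AutKNP_closed.
Definition OutKNP : groupClosed OutN := imgroup (cls (cmplK KNP)) AutKNP.

Section Compatible.
Variables (Q : groupType) (Theta : {multiplicative Q -> OutN}).

Definition compatible (eta : AutN) : Prop :=
  forall q, commute (cls (cmplK KNP) eta) (Theta q).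

Fact AutTheta_closed :
  group_closed [pred eta : AutN | (eta \in AutKNP) && `[< compatible eta >]].
Proof.
split.
  apply/andP; split; first exact: gpred1.
  by apply/asboolP => q; rewrite mulf1; exact: commute_sym (commute1 _).
move=> a b /andP[Aa /asboolP Ca] /andP[Ab /asboolP Cb]; apply/andP.
split; first exact: gpredF.
apply/asboolP => q; rewrite /compatible gmulfM mulfV.
apply: commute_sym; apply: commuteM; last apply: commuteV.
  exact: commute_sym.
exact: commute_sym.
Qed.
Definition AutTheta : groupClosed AutN := mkgroup AutTheta_closed.
Definition OutTheta : groupClosed OutN := imgroup (cls (cmplK KNP)) AutTheta.
End Compatible.

(* The automorphism n |-> l(pi0(n)) n attached to a cocycle l.                *)
Section Star.
Variables (Q R : groupType) (PQR : extension P Q R).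
Variable theta : {multiplicative Q -> Out K}.
Hypothesis hKNP : forall p, outer_action KNP p = theta (inc PQR p).
Local Notation M := (res_module (inc PQR) (center_module theta)).
Implicit Types l : Z1 M.

Definition star_fun l (n : N) : N := i0 (center_val (l (pi0 n))) * n.

Lemma center_act n (z : center K) :
  i0 (center_val (M (pi0 n) z)) = n * i0 (center_val z) * n^-1.
Proof.
rewrite -[M _ _]/(out_center (theta (inc PQR (pi0 n))) z) -hKNP.
by rewrite outer_actionE out_centerE /= resE.
Qed.

Fact star_funM l : {morph star_fun l : x y / x * y}.
Proof.
move=> x y; rewrite /star_fun gmulfM Z1E centerME gmulfM center_act.
by rewrite !mulgA mulgVK.
Qed.

Lemma prj_star l n : pi0 (star_fun l n) = pi0 n.
Proof. by rewrite /star_fun gmulfM prj_inc mul1g. Qed.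

Lemma star_funK l : cancel (star_fun l) (star_fun l^-1).
Proof.
move=> n; rewrite /star_fun -/(star_fun l n) prj_star /star_fun Z1VE mulgA.
by rewrite -gmulfM mulVg mulf1 mul1g.
Qed.

Fact star_fun_bij l : bijective (star_fun l).
Proof.
have lK : cancel (star_fun l^-1) (star_fun l).
  by have := star_funK l^-1; rewrite invgK.
exact: Bijective (star_funK l) lK.
Qed.

Lemma star_ext_aut l : is_extension_aut (aut_of (@star_funM l) (star_fun_bij l)).
Proof.
split=> [k|n]; last exact: prj_star.
by rewrite /= /star_fun prj_inc cocycle1 mulf1 mul1g.
Qed.

Definition star l : AutN :=
  Subg (introT (asboolP _) (extension_aut_preservesK (star_ext_aut l))
    : _ \in AutK_set KNP).

Lemma starE l n : star l n = i0 (center_val (l (pi0 n))) * n. Proof. by []. Qed.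

Lemma star_AutKNP l : star l \in AutKNP.
Proof. by apply/asboolP; exact: star_ext_aut. Qed.
End Star.
End Automorphisms.

(* Main.v *)
Require Import Defs.
From mathcomp Require Import all_boot.
From HB Require Import structures.

(** Every automorphism [eta] of [N] that is the identity on [K] and on [P]
    differs from the identity by a function [n |-> eta n * n^-1] with values in
    [K]; since [n] and [eta n] act on [K] in the same way, these values are
    central in [K], depend on [pi0 n] only, and form a cocycle. Hence [star]
    is an isomorphism from [Z^1(P, Z(K))] onto [Aut(KNP)].  It sends the
    coboundary of [a] to conjugation by [a^-1], and conversely a conjugation by
    [k] in [K] that fixes [K] pointwise has [k] central, so the cocycles whose
    class in [Out(N;K)] is trivial are exactly the coboundaries
    ([cls_star_eq1]).  The first isomorphism theorem ([kernel_image_iso]) then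
    gives the isomorphism of [H^1(P, Z(K))] with [Out(KNP;K)].

    The restriction comes from equivariance ([Theta_star]): if [a] represents
    [Theta q], then [a o star l o a^-1] is [star] of the conjugated cocycle
    [^q l], because [a] induces [theta q] on [Z(K)] and conjugation by [q] on
    [P].  So [star l] commutes with all [Theta q] in [Out(N;K)] if and only if
    the class of [star l] equals that of [star (^q l)] for all [q], and by
    injectivity this says that the class of [l] is fixed by [R]
    ([compatible_star]). *)

Set Implicit Arguments.
Unset Strict Implicit.
Unset Printing Implicit Defensive.

Local Open Scope group_scope.

(** * Isomorphisms of subgroups and quotients *)

Lemma inj_surj_bij (A B : Type) (f : A -> B) :
  injective f -> (forall y, exists x, f x = y) -> bijective f.
Proof.
by move=> fI /choice[g fg]; exists g => // x; apply: fI; rewrite fg.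
Qed.

Lemma mulVg_eq1 (G : groupType) (x y : G) : x^-1 * y = 1 <-> x = y.
Proof.
split=> [xy1 | ->]; last exact: mulVg.
by apply/esym/(mulgI x^-1); rewrite xy1 mulVg.
Qed.

(** The first isomorphism theorem. The kernel and the image enter through
    membership equivalences, so that [S] and [T] may be subgroups that are
    defined independently of [phi], such as coboundaries and [Out(KNP;K)]. *)
Lemma kernel_image_iso (G H : groupType) (phi : {multiplicative G -> H})
    (S : normalSubgroup G) (T : groupClosed H) :
    (forall x, phi x = 1 <-> x \in S) ->
    (forall y, y \in T <-> exists x, phi x = y) ->
  exists2 f : {multiplicative quotg S -> subg T},
    forall x, sgval (f (cls S x)) = phi x & bijective f.
Proof.
move=> kerS imT.
have phi_eq x y : phi x = phi y <-> cls S x = cls S y.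
  by rewrite clsP -kerS gmulfM mulfV mulVg_eq1.
have Tphi (c : quotg S) : phi (repr c) \in T by apply/imT; exists (repr c).
pose f (c : quotg S) : subg T := Subg (Tphi c).
have fE x : sgval (f (cls S x)) = phi x by apply/phi_eq; rewrite cls_repr.
have fM : {morph f : c d / c * d}.
  move=> c d; apply: val_inj; rewrite -(cls_repr c) -(cls_repr d) -clsM.
  by rewrite [LHS]fE gmulfM -!fE.
pose F : {multiplicative quotg S -> subg T} :=
  HB.pack f (isMultiplicative.Build _ _ f fM).
exists F => //; apply: inj_surj_bij => [c d cd | y].
  rewrite -(cls_repr c) -(cls_repr d); apply/phi_eq.
  by rewrite -!fE !cls_repr; congr sgval.
have /imT[x xy] := sgvalP y; exists (cls S x).
by apply: val_inj; rewrite [LHS]fE.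
Qed.

(** The restriction reaches all of [U] because an element of [U] lies in [T],
    hence is a value of [f], and its preimage is then in [S]. *)
Lemma restrict_iso (G H : groupType) (T U : groupClosed H)
    (f : {multiplicative G -> subg T}) (S : groupClosed G) :
    bijective f -> {subset U <= T} ->
    (forall x, x \in S <-> sgval (f x) \in U) ->
  exists2 g : {multiplicative subg S -> subg U},
    forall x, sgval (g x) = sgval (f (sgval x)) & bijective g.
Proof.
move=> fB UT fS.
have Uf (x : subg S) : sgval (f (sgval x)) \in U by apply/fS/sgvalP.
pose g x : subg U := Subg (Uf x).
have gM : {morph g : x y / x * y}.
  by move=> x y; apply: val_inj; rewrite /= gmulfM.
pose g' : {multiplicative subg S -> subg U} :=
  HB.pack g (isMultiplicative.Build _ _ g gM).
exists g' => //; apply: inj_surj_bij => [x y xy | y].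
  by apply/val_inj/(bij_inj fB)/val_inj; exact: (congr1 val xy).
have [h _ hK] := fB; pose z : subg T := Subg (UT _ (sgvalP y)).
have Sz : h z \in S by apply/fS; rewrite hK; exact: sgvalP.
by exists (Subg Sz); apply: val_inj; rewrite /= hK.
Qed.

(** * Extension automorphisms and cocycles *)

Section Star.
Variables (K N P Q R : groupType) (PQR : extension P Q R).
Variables (theta : {multiplicative Q -> Out K}) (KNP : extension K N P).
Hypothesis hKNP : forall p, outer_action KNP p = theta (inc PQR p).
Local Notation i0 := (inc KNP).
Local Notation pi0 := (prj KNP).
Local Notation ZK := (center_module theta).
Local Notation M := (res_module (inc PQR) ZK).
Local Notation cl := (cls (cmplK KNP)).
Local Notation star := (star hKNP).
Implicit Types (l m : Z1 M) (a eta : AutK KNP).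

Lemma AutK_eq a a' : (forall n, a n = a' n) -> a = a'.
Proof. by move=> eq_aa'; apply/val_inj/autP. Qed.

Lemma starM : {morph star : l m / l * m}.
Proof.
move=> l m; apply: AutK_eq => n.
rewrite AutKME [in RHS]starE prj_star !starE Z1ME.
by rewrite centerME gmulfM mulgA.
Qed.

(** Since [star l] fixes [K] pointwise, [k] is central; then [l] is the
    coboundary of [k^-1]. *)
Lemma inner_star_B1 k l :
  (forall n, i0 k * n * (i0 k)^-1 = star l n) -> l \in B1 M.
Proof.
move=> kl; have Zk : k \in center_set K.
  apply/asboolP => x; apply: (@inc_inj _ _ _ KNP); rewrite !gmulfM.
  have := kl (i0 x); rewrite starE prj_inc cocycle1 mulf1 mul1g => kx.
  by rewrite -[in RHS]kx mulgVK.
pose z : center K := Subg Zk.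
apply/asboolP; exists z^-1 => p; rewrite -(lftK KNP p); set n := lft _ p.
apply: centerP; apply: (@inc_inj _ _ _ KNP); apply: (mulIg n).
rewrite /cobound invgK centerME gmulfM (center_act hKNP) -[LHS]/(star l n) -kl.
rewrite -[RHS]/(i0 k * (n * i0 (k^-1) * n^-1) * n) mulfV.
by rewrite !mulgA mulgVK.
Qed.

Lemma star_cobound (z : center K) l :
  l =1 cobound M z -> forall n, star l n = i0 (z : K)^-1 * n * i0 (z : K).
Proof.
move=> lz n; rewrite starE lz /cobound centerME gmulfM (center_act hKNP).
by rewrite !mulgA mulgVK.
Qed.

Lemma cls_star_eq1 l : cl (star l) = 1 <-> l \in B1 M.
Proof.
have cl1 : cl (star l) = 1 <-> exists k, innerK KNP (i0 k) = star l.
  rewrite -[1]/(cl 1); split=> [/esym/clsP/asboolP[k ek] | [k ek]].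
    by exists k; rewrite ek invg1 mul1g.
  by apply/esym/clsP/asboolP; exists k; rewrite invg1 mul1g.
rewrite cl1; split=> [[k ek] | /asboolP[z lz]].
  have kl n : i0 k * n * (i0 k)^-1 = star l n by rewrite -ek.
  exact: inner_star_B1 kl.
exists (z : K)^-1; apply: AutK_eq => n.
by rewrite (star_cobound lz) /= /conjl mulfV invgK.
Qed.

Lemma cls_star_eq l m :
  cl (star l) = cl (star m) <-> cls (B1 M) l = cls (B1 M) m.
Proof.
have starV : star l^-1 = (star l)^-1.
  apply: (mulgI (star l)); rewrite -starM !mulgV.
  by apply: AutK_eq => n; rewrite starE mulf1 mul1g.
rewrite [X in _ <-> X]clsP -cls_star_eq1 starM starV clsM (mulfV cl).
exact: iff_sym (mulVg_eq1 _ _).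
Qed.

(** As [eta] fixes [K] pointwise, [n] and [eta n] conjugate [K] in the same way,
    so their quotient [c n] in [K] is central; this centrality is also what
    makes [c] constant on the cosets of [K]. *)
Lemma star_surj eta : eta \in AutKNP KNP -> exists l, star l = eta.
Proof.
move=> /asboolP[etaK etaP].
have /choice[c cE] : forall n, exists k, eta n = i0 k * n.
  by move=> n; apply: prj_eq; apply: etaP.
have Zc n : c n \in center_set K.
  apply/asboolP => k; apply: (@inc_inj _ _ _ KNP); rewrite !gmulfM.
  have [k' ek'] := AutK_inc (innerK KNP n^-1) k.
  have ek : i0 k = n * i0 k' * n^-1.
    by rewrite ek' /= /conjl invgK !mulgA mulgV mul1g mulgK.
  have kn : i0 k * n = n * i0 k' by rewrite ek mulgVK.
  apply: (mulIg n); rewrite -[i0 (c n) * _ * _]mulgA kn mulgA -cE.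
  by rewrite -(etaK k') -(autM eta) -kn autM etaK cE mulgA.
have cM x y : i0 (c (x * y)) = i0 (c x) * (x * i0 (c y) * x^-1).
  by apply: (mulIg (x * y)); rewrite -cE autM !cE !mulgA !mulgVK.
have cK k n : c (i0 k * n) = c n.
  apply: (@inc_inj _ _ _ KNP); apply: (mulIg (i0 k * n)).
  rewrite -cE autM etaK cE !mulgA -!gmulfM.
  by have /asboolP/(_ k) -> := Zc n.
pose l0 : cochain P (center K) := fun p => Subg (Zc (lft KNP p)).
have l0E n : center_val (l0 (pi0 n)) = c n.
  have [k ->] : exists k, n = i0 k * lft KNP (pi0 n).
    by apply: prj_eq; rewrite lftK.
  by rewrite cK gmulfM prj_inc mul1g lftK.
have Zl0 : cocycle M l0.
  move=> p p'; rewrite -(lftK KNP p) -(lftK KNP p').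
  move: (lft _ p) (lft _ p') => x y; apply: centerP.
  apply: (@inc_inj _ _ _ KNP); rewrite -gmulfM l0E cM centerME [RHS]gmulfM.
  by rewrite (center_act hKNP) !l0E -[c x]l0E.
by exists (mkZ1 Zl0); apply: AutK_eq => n; rewrite starE cE -l0E.
Qed.

(** * Compatible automorphisms and invariant classes *)

Section Compatible.
Variable Theta : {multiplicative Q -> OutK KNP}.
Hypothesis hTheta : is_prolongation PQR theta Theta.

(** If [a] represents [Theta q], the two sides are already equal as
    automorphisms of [N] before passing to classes: this is where both
    prolongation conditions enter, [theta q] governing the values of [l] and the
    conjugation action of [q] its argument. *)
Lemma Theta_star q l :
  Theta q * cl (star l) = cl (star (conjZ1 q l)) * Theta q.
Proof.
have [a ea] : exists a : AutK KNP, cl a = Theta q by exact: cls_surj.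
have aK : theta q = cls (Inn K) (res a).
  by rewrite -(prolong_Out hTheta) -ea OutK_OutE.
have aP : conj_action PQR q = ind a.
  by rewrite -(prolong_Aut hTheta) -ea OutK_AutE.
rewrite -ea -!clsM; congr cls; apply: AutK_eq => n.
rewrite !AutKME !starE autM; congr (_ * _).
rewrite -[center_val (conjZ1 _ _ _)]/(center_val (out_center (theta q)
  (l (conj_action PQR q^-1 (pi0 (a n)))))).
have -> : conj_action PQR q^-1 (pi0 (a n)) = pi0 n.
  rewrite -(indE a) -aP -autME -conj_actionM mulVg.
  by apply: (@inc_inj _ _ _ PQR); rewrite conj_actionE mul1g invg1 mulg1.
by rewrite aK out_centerE /= resE.
Qed.

Lemma compatible_star l :
  compatible Theta (star l) <-> cls (B1 M) l \in H1_inv PQR ZK.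
Proof.
have fixE q : commute (cl (star l)) (Theta q)
    <-> actH1 (prj PQR q) (cls (B1 M) l) = cls (B1 M) l.
  rewrite actH1_cls -cls_star_eq /commute Theta_star.
  by split=> [/mulIg | ->].
split=> [Cl | /asboolP Il q]; last exact/fixE.
by apply/asboolP => r; rewrite -(lftK PQR r); apply/fixE.
Qed.

(** A class belongs to [OutTheta] when some representative is compatible, but
    compatibility depends on the class alone, so it can be tested on [star l]. *)
Lemma mem_OutTheta l :
  cl (star l) \in OutTheta Theta <-> cls (B1 M) l \in H1_inv PQR ZK.
Proof.
rewrite -compatible_star; split=> [/asboolP[eta] | Cl].
  by move=> /andP[_ /asboolP Ceta] ecl q; rewrite -ecl.
apply/asboolP; exists (star l) => //; apply/andP; split.
  exact: star_AutKNP.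
exact/asboolP.
Qed.

Lemma OutTheta_sub_OutKNP : {subset OutTheta Theta <= OutKNP KNP}.
Proof.
by move=> _ /asboolP[eta /andP[Aeta _] <-]; apply/asboolP; exists eta.
Qed.

End Compatible.
End Star.

(** * The two isomorphisms *)

Theorem corollary7p9 (K N P Q R : groupType)
  (PQR : extension P Q R)
  (theta : {multiplicative Q -> Out K})
  (KNP : extension K N P)
  (hKNP : forall p : P, outer_action KNP p = theta (inc PQR p))
  (Theta : {multiplicative Q -> OutK KNP})
  (hTheta : is_prolongation PQR theta Theta) :
  let ZK := center_module theta in
  let H1PZK := H1 (res_module (inc PQR) ZK) in
  exists (f : {multiplicative H1PZK -> subg (OutKNP KNP)})
         (g : {multiplicative subg (H1_inv PQR ZK) -> subg (OutTheta Theta)}),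
    [/\ forall l : Z1 (res_module (inc PQR) ZK),
          sgval (f (cls _ l)) = cls _ (star hKNP l),
        bijective f,
        forall c, sgval (g c) = sgval (f (sgval c)) &
        bijective g].
Proof.
move=> ZK H1PZK; set M := res_module (inc PQR) ZK.
pose phi (l : Z1 M) : OutK KNP := cls (cmplK KNP) (star hKNP l).
have phiM : {morph phi : l m / l * m}.
  by move=> l m; rewrite /phi starM clsM.
pose Phi : {multiplicative Z1 M -> OutK KNP} :=
  HB.pack phi (isMultiplicative.Build _ _ phi phiM).
have imPhi y : y \in OutKNP KNP <-> exists l, Phi l = y.
  split=> [/asboolP[eta Aeta <-] | [l <-]].
    by have [l <-] := star_surj hKNP Aeta; exists l.
  by apply/asboolP; exists (star hKNP l); first exact: star_AutKNP.
have kerPhi l : Phi l = 1 <-> l \in B1 M by exact: cls_star_eq1.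
have [f fE fB] := kernel_image_iso kerPhi imPhi.
have fS c : c \in H1_inv PQR ZK <-> sgval (f c) \in OutTheta Theta.
  by rewrite -(cls_repr c) fE; apply: iff_sym; exact: mem_OutTheta.
have [g gE gB] := restrict_iso fB (@OutTheta_sub_OutKNP _ _ _ _ _ Theta) fS.
by exists f, g; split.
Qed.
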